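(* Let $\mu$ be a Borel probability measure on $\mathbb{R}^d$. Suppose there exists a Borel set $E\subseteq\mathbb{R}^d$ with $\mu(E)>0$ and $\mu(E+k)=0$ for all $k\in\mathbb{Z}^d\setminus\{\mathbf{0}\}$. Then $\mathcal{Z}(\mu)=\emptyset$.
   Context: $\widehat{\mu}(\xi)=\int e^{-2\pi i\xi\cdot x}d\mu(x)$ and $\mathcal{Z}(\mu)=\{\xi\in\mathbb{R}^d:\widehat{\mu}(\xi+k)=0\text{ for all }k\in\mathbb{Z}^d\}$. *)

(* Defs.v *)
(* R^n is modelled as n.-tuple R, whose
   measurable structure is the product sigma-algebra generated by the
   coordinates (= Borel sigma-algebra of R^n). *)
From HB Require Import structures.
From mathcomp Require Import all_boot all_order all_algebra.
From mathcomp Require Import all_classical all_reals all_analysis.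
From mathcomp Require Import complex.
Set Implicit Arguments. Unset Strict Implicit. Unset Printing Implicit Defensive.
Import Order.TTheory GRing.Theory Num.Theory.
Local Open Scope classical_set_scope.
Local Open Scope ring_scope.

Section Defs.
Context {R : realType} {n : nat}.

Definition dotR (x y : n.-tuple R) : R := \sum_(i < n) tnth x i * tnth y i.

Definition tshift (x : n.-tuple R) (k : n.-tuple int) : n.-tuple R :=
  [tuple tnth x i + (tnth k i)%:~R | i < n].

Definition translate (E : set (n.-tuple R)) (k : n.-tuple int) : set (n.-tuple R) :=
  [set z | exists2 x, E x & z = tshift x k].

(* Fourier transform  \hat mu (xi) = \int e^{-2 pi i xi.x} d mu(x)
   = \int cos(2 pi xi.x) d mu - i \int sin(2 pi xi.x) d mu *)
Definition fourier (mu : {measure set (n.-tuple R) -> \bar R}) (xi : n.-tuple R)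
  : R[i] :=
  Complex (Rintegral mu setT (fun x => cos (2 * pi * dotR xi x)))
          (- Rintegral mu setT (fun x => sin (2 * pi * dotR xi x))).

Definition Zset (mu : {measure set (n.-tuple R) -> \bar R}) : set (n.-tuple R) :=
  [set xi | forall k : n.-tuple int, fourier mu (tshift xi k) = 0].

End Defs.

(* Main.v *)
Require Import Defs.
From HB Require Import structures.
From mathcomp Require Import all_boot all_order all_algebra.
From mathcomp Require Import all_classical all_reals all_analysis.
From mathcomp Require Import complex.
From mathcomp Require Import measurable_realfun ring lra.
Import Order.TTheory GRing.Theory Num.Theory.
Import numFieldNormedType.Exports.
Local Open Scope classical_set_scope.
Local Open Scope ring_scope.

(** If [xi] lies in [Zset mu], then for every phase [a] the signed measure
    [cos (2 pi xi.x + a) mu] annihilates all the functions [cos (2 pi k.x + t)]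
    with [k] integral.  Hence it annihilates every function obtained from these
    by linear combinations and bounded pointwise limits.  As a product of two
    such waves is a combination of waves, this class of functions is an algebra,
    so the sets whose indicator it contains form a sigma-algebra; that
    sigma-algebra makes the fractional part of each coordinate measurable, and
    so contains the periodization of every Borel set.  Take
    [E' = E n {cos (2 pi xi.x + a) > 0}]: up to a null set its periodization is
    [E'] itself, so the integral of a positive function over [E'] vanishes and
    [E'] is null.  Four values of [a] suffice to cover [E]. *)

(** * Polynomial iteration converging to a step function *)

Section smoothstep.
Context {R : realType}.
Implicit Types w : R.

(* Its iterates converge pointwise on [0, 1] to a step function at 1/2, so that
   they approximate indicators of superlevel sets by polynomials. *)
Definition smoothstep w : R := w * w * (3 - 2 * w).

Lemma smoothstep_itv w : 0 <= w <= 1 -> 0 <= smoothstep w <= 1.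
Proof.
move=> /andP[w0 w1]; rewrite /smoothstep; apply/andP; split.
  by rewrite !mulr_ge0//; lra.
rewrite -subr_ge0 (_ : _ - _ = (1 - w) * (1 - w) * (1 + 2 * w)); last by ring.
by rewrite !mulr_ge0//; lra.
Qed.

Lemma iter_smoothstep_itv w m :
  0 <= w <= 1 -> 0 <= iter m smoothstep w <= 1.
Proof. by move=> w01; elim: m => //= m; exact: smoothstep_itv. Qed.

(** Since [smoothstep] y = y * (y * (3 - 2 * y)) and the second factor increases up to 3/4, the
    iterates stay below [w] and shrink at least by the factor w * (3 - 2 * w) < 1. *)
Lemma iter_smoothstep_cvg0 w : 0 <= w < 1 / 2 ->
  (iter m smoothstep w) @[m --> \oo] --> (0 : R).
Proof.
(* [r] equals w * (3 - 2 * w); this form makes [r] < 1 evident. *)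
move=> /andP[w0 w2]; pose r : R := 1 - (1 - w) * (1 - 2 * w).
have r0 : 0 <= r by rewrite (_ : r = w * (3 - 2 * w)) ?mulr_ge0//;
  [lra|rewrite /r; ring].
have r1 : r < 1 by rewrite /r ltrBlDr ltrDl mulr_gt0//; lra.
have H m : 0 <= iter m smoothstep w <= w /\ iter m smoothstep w <= r ^+ m.
  elim: m => [|m [/andP[i0 iw] ir]] /=; first by rewrite w0 lexx expr0;
    split => //; lra.
  set y := iter m _ w in i0 iw ir *.
  have ry : y * (3 - 2 * y) <= r.
    rewrite -subr_ge0 (_ : _ - _ = (w - y) * (3 - 2 * (w + y))).
      by rewrite mulr_ge0//; lra.
    by rewrite /r; ring.
  have yr : smoothstep y <= r * y.
    by rewrite /smoothstep -mulrA mulrC ler_wpM2r.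
  split; last by rewrite exprS (le_trans yr)// ler_wpM2l.
  apply/andP; split; first by rewrite /smoothstep !mulr_ge0//; lra.
  by rewrite (le_trans yr)// (le_trans _ iw)// ler_piMl// ltW.
apply: (@squeeze_cvgr _ _ _ _ (cst 0) (fun m => r ^+ m)).
- by near=> m; have [/andP[-> _] ->] := H m.
- exact: cvg_cst.
- by apply: cvg_expr; rewrite ger0_norm.
Unshelve. all: by end_near. Qed.

(** [smoothstep] commutes with the reflection of w to 1 - w, which reduces w > 1/2 to w < 1/2 and
    makes 1/2 a fixed point. *)
Lemma iter_smoothstep_cvg w : 0 <= w <= 1 ->
  (iter m smoothstep w) @[m --> \oo] -->
  (if 1 / 2 < w then 1 else if w < 1 / 2 then 0 else 1 / 2 : R).
Proof.
move=> /andP[w0 w1]; case: ltgtP => [w2|w2|<-].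
- have H m : iter m smoothstep w = 1 - iter m smoothstep (1 - w).
    by elim: m => [|m /= ->]; rewrite /= ?/smoothstep; ring.
  rewrite (eq_cvg _ _ H).
  have /iter_smoothstep_cvg0 h : 0 <= 1 - w < 1 / 2 by apply/andP; split; lra.
  by have := cvgB (cvg_cst (1 : R)) h; rewrite subr0; apply.
- by apply: iter_smoothstep_cvg0; rewrite w0.
- under eq_fun => m.
    have -> : iter m smoothstep (1 / 2) = 1 / 2.
      by elim: m => //= m ->; rewrite /smoothstep; field.
    over.
  exact: cvg_cst.
Qed.

End smoothstep.

(** * Closure under linear combinations and bounded pointwise limits *)

Section bounded_limit_closure.
Context {R : realType} {T : Type}.
Implicit Types (A : set (T -> R)) (f g : T -> R).

(** An inductive predicate lets properties of [A] spread by induction; the uniform bound [C] in the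
    limit case is what dominated convergence requires. *)
Inductive blclosure A : (T -> R) -> Prop :=
| blclosure_base f : A f -> blclosure A f
| blclosure_lin a f g : blclosure A f -> blclosure A g ->
    blclosure A (fun x => a * f x + g x)
| blclosure_lim (u : nat -> T -> R) f C : (forall m, blclosure A (u m)) ->
    (forall m x, `|u m x| <= C) -> (forall x, u ^~ x @ \oo --> f x) ->
    blclosure A f.

Definition blclosure_set A : set (set T) := [set F | blclosure A \1_F].

Context (A : set (T -> R)).
Hypothesis A1 : A (cst 1).
Hypothesis A_bounded : forall f, A f -> exists C : R, forall x, `|f x| <= C.
Hypothesis A_mul : forall f g, A f -> A g -> blclosure A (fun x => f x * g x).

Let V := blclosure A.

Lemma blclosure_bounded f : V f -> exists C : R, forall x, `|f x| <= C.
Proof.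
elim=> {f} [f /A_bounded//|a f g _ [C fC] _ [D gD]|u f C _ _ uC uf].
  exists (`|a| * C + D) => x; rewrite (le_trans (ler_normD _ _))// normrM.
  by rewrite lerD// ler_wpM2l.
exists C => x; have /cvg_norm ufx := uf x.
by apply: (cvgr_to_le ufx); near=> m; exact: uC.
Unshelve. all: by end_near. Qed.

Lemma blclosure0 : V (cst 0).
Proof.
have := blclosure_lin A (-1) (cst 1) (cst 1).
rewrite (_ : (fun x => _) = cst 0).
  by apply; exact: blclosure_base.
by apply/funext => x /=; ring.
Qed.

Lemma blclosureZ a f : V f -> V (fun x => a * f x).
Proof.
move=> Vf; have := blclosure_lin A a f (cst 0) Vf blclosure0.
by rewrite (_ : (fun x => _) = (fun x => a * f x))//; apply/funext => x;
  rewrite addr0.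
Qed.

Lemma blclosureD f g : V f -> V g -> V (fun x => f x + g x).
Proof.
move=> Vf Vg; have := blclosure_lin A 1 f g Vf Vg.
by rewrite (_ : (fun x => _) = (fun x => f x + g x))//; apply/funext => x;
  rewrite mul1r.
Qed.

Lemma blclosure_cst a : V (cst a).
Proof.
have := blclosureZ a (cst 1) (blclosure_base A (cst 1) A1).
by rewrite (_ : (fun x => _) = cst a)//; apply/funext => x /=; rewrite mulr1.
Qed.

Lemma blclosureB f g : V f -> V g -> V (fun x => f x - g x).
Proof.
move=> Vf Vg; have := blclosureD _ _ Vf (blclosureZ (-1) g Vg).
by rewrite (_ : (fun x => _) = (fun x => f x - g x))//; apply/funext => x; ring.
Qed.

(* [blclosureM] is a double induction: first with [g] in [A], then with [g]
   arbitrary. *)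
Let blclosure_mulr g : (exists C : R, forall x, `|g x| <= C) ->
  (forall f, A f -> V (fun x => f x * g x)) ->
  forall f, V f -> V (fun x => f x * g x).
Proof.
move=> [D gD] Ag f; elim=> {f} [f /Ag//|a f h _ Vf _ Vh|u f C _ Vu uC uf].
  have := blclosure_lin A a _ _ Vf Vh.
  by rewrite (_ : (fun x => _) = (fun x => (a * f x + h x) * g x))//;
    apply/funext => x; ring.
apply: (@blclosure_lim _ (fun m x => u m x * g x) _ (C * D)) => //.
  by move=> m x; rewrite normrM ler_pM.
by move=> x; apply: cvgM; [exact: uf|exact: cvg_cst].
Qed.

Lemma blclosureM f g : V f -> V g -> V (fun x => f x * g x).
Proof.
move=> Vf Vg; apply: blclosure_mulr => //; first exact: blclosure_bounded.
move=> h Ah; under eq_fun do rewrite mulrC.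
by apply: blclosure_mulr => //; [exact: A_bounded|move=> k Ak; exact: A_mul].
Qed.

Lemma blclosureX f m : V f -> V (fun x => f x ^+ m).
Proof.
move=> Vf; elim: m => [|m IH].
  by under eq_fun do rewrite expr0; exact: (blclosure_cst 1).
by under eq_fun do rewrite exprS; exact: blclosureM.
Qed.

(** A complement has indicator 1 - [\1_F]; a countable union is the bounded limit of 1 minus the
    finite products of the 1 - [\1_(F i)], available because the closure is an algebra. *)
Lemma sigma_algebra_blclosure_set : sigma_algebra setT (blclosure_set A).
Proof.
split => [|F VF|F VF]; rewrite /blclosure_set/=.
- by rewrite indic0; exact: blclosure0.
- rewrite setTD (_ : \1_ _ = fun x => cst 1 x - \1_F x).
    exact: (blclosureB _ _ (blclosure_cst 1) VF).
  by apply/funext => x; rewrite !indicE in_setC/=; case: (x \in F);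
    rewrite ?subrr ?subr0.
- have Vm m : V (fun x => \prod_(i < m) (1 - \1_(F i) x)).
    elim: m => [|m IH].
      by under eq_fun do rewrite big_ord0; exact: (blclosure_cst 1).
    rewrite (_ : (fun _ => _) = fun x => \prod_(i < m)
      (1 - \1_(F i) x) * (1 - \1_(F m) x)).
      exact: (blclosureM _ _ IH (blclosureB _ _ (blclosure_cst 1) (VF m))).
    by apply/funext => x; rewrite big_ord_recr.
  have Fi x i : 1 - \1_(F i) x = (~~ (x \in F i))%:R :> R.
    by rewrite indicE; case: (_ \in _); rewrite ?subrr ?subr0.
  apply: (@blclosure_lim _ (fun m x => 1 - \prod_(i < m) (1 - \1_(F i) x)) _ 1).
  + by move=> m; exact: (blclosureB _ _ (blclosure_cst 1) (Vm m)).
  + move=> m x; have : 0 <= \prod_(i < m) (1 - \1_(F i) x : R) <= 1.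
      apply: (big_ind (fun p : R => 0 <= p <= 1)) => [|p q|i _].
      * by rewrite ler01 lexx.
      * by move=> /andP[? ?] /andP[? ?]; rewrite mulr_ge0//= mulr_ile1.
      * by rewrite Fi ler0n lern1 leq_b1.
    by move=> /andP[? ?]; rewrite ger0_norm; lra.
  (* At a fixed [x] the product is eventually constant: 0 once an index [i] with [x] in [F i] has
     entered, and always 1 if there is none. *)
  + move=> x; apply: cvg_near_cst; rewrite indicE; case: (boolP (x \in _)).
      rewrite inE => -[i _ Fix]; exists i.+1 => // m /= im.
      rewrite (bigD1 (Ordinal im))//= Fi mem_set//= mul0r subr0//.
    move=> xF; near=> m; rewrite big1 ?subrr// => i _; rewrite Fi.
    case: (boolP (x \in F i)) => // xFi; case/negP: xF.
    by apply/mem_set; exists i => //; exact/set_mem.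
Unshelve. all: by end_near. Qed.

(** An affine change sends [t] to 1/2 and the values of [f] into [0, 1]. The iterates of
    [smoothstep] are polynomials in the result, and tend to the indicator except for the value 1/2
    where [f] equals [t]. *)
Lemma blclosure_set_gt f t : V f -> blclosure_set A [set x | t < f x].
Proof.
move=> Vf; have [C fC] := blclosure_bounded f Vf.
(* [K] bounds |f - t|; the summand 1 makes it positive. *)
pose K := `|C| + `|t| + 1.
have K0 : 0 < K by rewrite /K ltr_wpDl// addr_ge0.
pose w x := (f x - t) / (2 * K) + 1 / 2.
have Vw : V w.
  have := blclosureD _ _ (blclosureZ (2 * K)^-1 _ (blclosureB _ _ Vf
    (blclosure_cst t))) (blclosure_cst (1 / 2)).
  by rewrite (_ : (fun x => _) = w)//; apply/funext => x; rewrite /w/= mulrC.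
have w01 x : 0 <= w x <= 1.
  have : `|(f x - t) / (2 * K)| <= 1 / 2.
    rewrite normrM normfV (gtr0_norm (_ : 0 < 2 * K)) ?mulr_gt0//.
    rewrite ler_pdivrMr ?mulr_gt0// mulrA (_ : 1 / 2 * 2 = 1) ?mul1r;
      last by field.
    rewrite (le_trans (ler_normB _ _))// /K.
    have := fC x; have := ler_norm C; lra.
  by rewrite ler_norml /w => /andP[? ?]; apply/andP; split; lra.
have wE x : (t < f x) = (1 / 2 < w x).
  by rewrite /w ltrDr pmulr_lgt0 ?subr_gt0// invr_gt0 mulr_gt0.
have Vi m : V (fun x => iter m smoothstep (w x)).
  elim: m => [//|m IH] /=; rewrite /smoothstep.
  apply: blclosureM; first exact: blclosureM.
  by apply: blclosureB; [exact: (blclosure_cst 3)|exact: blclosureZ].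
pose phi x : R := if 1 / 2 < w x then 1 else if w x < 1 / 2 then 0 else 1 / 2.
have Vphi : V phi.
  apply: (blclosure_lim _ _ _ 1 Vi).
    move=> m x; have /andP[h0 h1] := iter_smoothstep_itv _ m (w01 x).
    by rewrite ger0_norm.
  by move=> x; exact: iter_smoothstep_cvg.
(* Powers keep 0 and 1 and send the unwanted value 1/2 to 0; the exponent starts at 1 because 0 ^+ 0
   is 1. *)
apply: (@blclosure_lim _ (fun m x => phi x ^+ m.+1) _ 1).
- by move=> m; exact: blclosureX.
- move=> m x; rewrite normrX exprn_ile1// /phi.
  by case: ifP => _; [|case: ifP => _]; rewrite ger0_norm//; lra.
- move=> x; rewrite indicE (_ : (x \in _) = (1 / 2 < w x)); last first.
    by apply/idP/idP; rewrite inE/= wE.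
  rewrite /phi; case: ifPn => _.
    by under eq_fun do rewrite expr1n; exact: cvg_cst.
  case: ifPn => _.
    by under eq_fun do rewrite expr0n/=; exact: cvg_cst.
  have h : `|1 / 2 : R| < 1 by rewrite ger0_norm; lra.
  have := cvgM (cvg_cst (1 / 2 : R)) (cvg_expr h); rewrite mulr0.
  by rewrite (eq_cvg _ _ (fun m => exprS _ m)); apply.
Qed.

End bounded_limit_closure.

(** * Vanishing integrals pass to the closure *)

Section blclosure_integral.
Context {R : realType} {d : measure_display} {T : measurableType d}.
Variables (mu : {measure set T -> \bar R}) (w : T -> R) (A : set (T -> R)).
Hypothesis iw : mu.-integrable setT (EFin \o w).
Hypothesis A_bounded : forall f, A f -> exists C : R, forall x, `|f x| <= C.
Hypothesis A_meas : forall f, A f -> measurable_fun setT f.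
Hypothesis A_int0 : forall f, A f -> (\int[mu]_x (w x * f x)%:E = 0)%E.

Lemma integrable_mul_bounded (f : T -> R) : measurable_fun setT f ->
  (exists C : R, forall x, `|f x| <= C) ->
  mu.-integrable setT (fun x => (w x * f x)%:E).
Proof.
move=> mf [C fC]; apply: (integrableMl measurableT iw mf).
exists C; split; first exact: num_real.
by move=> y Cy x _; exact: le_trans (fC x) (ltW Cy).
Qed.

Lemma blclosure_meas f : blclosure A f -> measurable_fun setT f.
Proof.
elim=> {f} [f /A_meas//|a f g _ mf _ mg|u f C _ mu_ uC uf].
  by apply: measurable_funD => //; exact: measurable_funM.
by apply: (measurable_fun_cvg mu_) => x _; exact: uf.
Qed.

(** The integral splits over linear combinations since bounded measurable functions are integrable
    against [w]; for limits, |w| * C dominates. *)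
Lemma blclosure_integral0 f : blclosure A f ->
  (\int[mu]_x (w x * f x)%:E = 0)%E.
Proof.
elim=> {f} [f /A_int0//|a f g Vf f0 Vg g0|u f C Vu u0 uC uf].
  have If : mu.-integrable setT (fun x => (w x * f x)%:E).
    by apply: integrable_mul_bounded;
      [exact: blclosure_meas|exact: blclosure_bounded Vf].
  have Ig : mu.-integrable setT (fun x => (w x * g x)%:E).
    by apply: integrable_mul_bounded;
      [exact: blclosure_meas|exact: blclosure_bounded Vg].
  transitivity (\int[mu]_x (a%:E * (w x * f x)%:E + (w x * g x)%:E))%E.
    by apply: eq_integral => x _; rewrite -EFinM -EFinD; congr (_%:E); ring.
  by rewrite integralD//= ?integralZl// ?f0 ?g0 ?mule0 ?adde0//;
    exact: integrableZl.
have mf : measurable_fun setT f by apply: blclosure_meas;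
  exact: blclosure_lim uC uf.
have mw : measurable_fun setT w by exact/measurable_EFinP/(measurable_int mu
  iw).
have Iw : mu.-integrable setT (fun x => (`|w x| * C)%:E).
  have := integrableZr measurableT C (integrable_abse iw).
  by apply: eq_integrable => // x _.
have [||||| _ _] := @dominated_convergence _ _ _ mu setT measurableT
  (fun m x => (w x * u m x)%:E) (fun x => (w x * f x)%:E) (fun x =>
    (`|w x| * C)%:E).
- move=> m; apply/measurable_EFinP; apply: measurable_funM => //.
  exact: blclosure_meas.
- by apply/measurable_EFinP; exact: measurable_funM.
- apply/aeW => x _; apply: cvg_EFin; first by near=> m.
  by apply: cvgM; [exact: cvg_cst|exact: uf].
- exact: Iw.
- by apply/aeW => x m _ /=; rewrite lee_fin normrM ler_wpM2l.
under eq_fun do rewrite u0.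
by move=> /cvg_lim <- //; rewrite lim_cst.
Unshelve. all: by end_near. Qed.

Lemma blclosure_set_integral0 F : blclosure_set A F ->
  measurable F /\ (\int[mu]_(x in F) (w x)%:E = 0)%E.
Proof.
move=> AF; split.
  have := blclosure_meas _ AF measurableT [set 1] (measurable_set1 _).
  by rewrite setTI preimage_indic mem_set//= (_ : 0 \in _ = false) ?setIT//
    memNset//= => /eqP; rewrite eq_sym oner_eq0.
rewrite -[RHS](blclosure_integral0 _ AF) integral_mkcond.
apply: eq_integral => x _; rewrite patchE indicE; case: ifP => _.
  by rewrite mulr1.
by rewrite mulr0.
Qed.

End blclosure_integral.

(** * Fractional parts recovered from cosine and sine *)

Section fracpart.
Context {R : realType}.
Implicit Types y a t : R.

Definition fracpart y : R := y - (Num.floor y)%:~R.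

Lemma fracpart_itv y : 0 <= fracpart y < 1.
Proof.
have /andP[h1 h2] := floor_itv y; rewrite /fracpart subr_ge0 h1/= ltrBlDr addrC.
by move: h2; rewrite intrD.
Qed.

Lemma periodicz (f : R -> R) t : periodic f t ->
  forall (m : int) (x : R), f (x + t * m%:~R) = f x.
Proof.
move=> ft [m|m] x.
  by rewrite -pmulrn mulr_natr (periodicn ft).
by rewrite NegzE mulrNz mulrN -pmulrn mulr_natr -[LHS](periodicn ft m.+1) subrK.
Qed.

Lemma cos_fracpart y : cos (2 * pi * fracpart y) = cos (2 * pi * y).
Proof.
rewrite -[LHS](periodicz cos _ (@cosD2pi R) (Num.floor y)) /fracpart.
by congr cos; ring.
Qed.

Lemma sin_fracpart y : sin (2 * pi * fracpart y) = sin (2 * pi * y).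
Proof.
rewrite -[LHS](periodicz sin _ (@sinD2pi R) (Num.floor y)) /fracpart.
by congr sin; ring.
Qed.

Lemma sin2pi_lt0 t : 0 <= t < 1 -> (sin (2 * pi * t) < 0) = (1 / 2 < t).
Proof.
move=> /andP[t0 t1]; have p0 := pi_gt0 R; case: (ltP (1 / 2) t) => t2.
  have -> : 2 * pi * t = - (2 * pi * (1 - t)) + pi *+ 2 by ring.
  rewrite sinD2pi sinN oppr_lt0 sin_gt0_pi//; apply/andP; split; nra.
apply/negbTE; rewrite -leNgt sin_ge0_pi//; apply/andP; split; nra.
Qed.

Lemma ltr_cos2pi t a : 0 <= t <= 1 / 2 -> 0 <= a <= 1 / 2 ->
  (cos (2 * pi * t) < cos (2 * pi * a)) = (a < t).
Proof.
move=> /andP[t0 t2] /andP[a0 a2]; have p0 := pi_gt0 R.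
rewrite ltr_cos ?in_itv/=; [|apply/andP; split; nra|apply/andP; split; nra].
by rewrite ltr_pM2l// mulr_gt0.
Qed.

Lemma cos2piC t : cos (2 * pi * (1 - t)) = cos (2 * pi * t).
Proof.
have -> : 2 * pi * (1 - t) = - (2 * pi * t) + pi *+ 2 by ring.
by rewrite cosD2pi cosN.
Qed.

(** Over a period, the sine is negative exactly on the open second half, all of which exceeds [a];
    on the first half the cosine decreases. *)
Lemma lt_fracpart_half a y : 0 <= a < 1 / 2 ->
  (a < fracpart y) =
  (sin (2 * pi * y) < 0) || (cos (2 * pi * y) < cos (2 * pi * a)).
Proof.
move=> /andP[a0 a2]; rewrite -sin_fracpart -(cos_fracpart y).
have /andP[f0 f1] := fracpart_itv y; rewrite sin2pi_lt0 ?f0//.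
by case: (ltP (1 / 2) (fracpart y)) => f2 /=;
  [rewrite (lt_trans a2)|rewrite ltr_cos2pi ?f0 ?a0//= ltW].
Qed.

(** Only the second half of the period matters; the reflection of t to 1 - t carries it to the
    first, where the cosine decreases. *)
Lemma lt_half_fracpart a y : 1 / 2 <= a < 1 ->
  (a < fracpart y) =
  (sin (2 * pi * y) < 0) && (cos (2 * pi * a) < cos (2 * pi * y)).
Proof.
move=> /andP[a2 a1]; rewrite -sin_fracpart -(cos_fracpart y).
have /andP[f0 f1] := fracpart_itv y; rewrite sin2pi_lt0 ?f0//.
case: (ltP (1 / 2) (fracpart y)) => f2 /=; last by apply/negbTE;
  rewrite -leNgt (le_trans f2).
rewrite -(cos2piC a) -(cos2piC (fracpart y)) ltr_cos2pi.
- by rewrite ltrD2l ltrN2.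
- by apply/andP; split; lra.
- by apply/andP; split; lra.
Qed.

(** The hypotheses concern only cosine and sine because [f] will be a coordinate on a sigma-algebra
    of periodic sets, which does not make [f] itself measurable. *)
Lemma measurable_fracpart d (T : measurableType d) (f : T -> R) :
  measurable_fun setT (fun x => cos (2 * pi * f x)) ->
  measurable_fun setT (fun x => sin (2 * pi * f x)) ->
  measurable_fun setT (fun x => fracpart (f x)).
Proof.
move=> mc ms; apply: (measurability _ (RGenOInfty.measurableE R)).
move=> _ [_ [a ->] <-]; rewrite setTI.
have [a0|a0] := ltP a 0.
  rewrite (_ : _ @^-1` _ = setT)//; apply/seteqP; split => // x _ /=.
  by have /andP[f0 _] := fracpart_itv (f x);
    rewrite in_itv/= andbT (lt_le_trans a0).
have [a1|a1] := leP 1 a.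
  rewrite (_ : _ @^-1` _ = set0)//; apply/seteqP; split => // x /=.
  have /andP[_ f1] := fracpart_itv (f x); rewrite in_itv/= andbT => af.
  by have := lt_trans (le_lt_trans a1 af) f1; rewrite ltxx.
have mset (g : T -> R) t : measurable_fun setT g ->
    measurable [set x | g x < t] /\ measurable [set x | t < g x].
  move=> mg; split.
    have := mg measurableT `]-oo, t[%classic (measurable_itv _).
    by rewrite setTI (_ : _ @^-1` _ = [set x | g x < t])//; apply/seteqP;
      split => x /=; rewrite in_itv.
  have := mg measurableT `]t, +oo[%classic (measurable_itv _).
  by rewrite setTI (_ : _ @^-1` _ = [set x | t < g x])//; apply/seteqP;
    split => x /=; rewrite in_itv/= andbT.
have [a2|a2] := ltP a (1 / 2).
  rewrite (_ : _ @^-1` _ = [set x | sin (2 * pi * f x) < 0] `|`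
      [set x | cos (2 * pi * f x) < cos (2 * pi * a)]).
    by apply: measurableU; [exact: (mset _ _ ms).1|exact: (mset _ _ mc).1].
  by apply/seteqP; split => x /=;
    rewrite in_itv/= andbT lt_fracpart_half ?a0//; move/orP.
rewrite (_ : _ @^-1` _ = [set x | sin (2 * pi * f x) < 0] `&`
    [set x | cos (2 * pi * a) < cos (2 * pi * f x)]).
  by apply: measurableI; [exact: (mset _ _ ms).1|exact: (mset _ _ mc).2].
by apply/seteqP; split => x /=; rewrite in_itv/= andbT lt_half_fracpart ?a2//;
  move/andP.
Qed.

End fracpart.

(** * Integral waves and periodized sets *)

Section trigonometric.
Context {R : realType} {n : nat}.
Implicit Types (k l : n.-tuple int) (x xi : n.-tuple R).

Definition idot k x : R := \sum_(i < n) (tnth k i)%:~R * tnth x i.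

Lemma idotD k l x :
  idot [tuple tnth k i + tnth l i | i < n] x = idot k x + idot l x.
Proof.
rewrite /idot -big_split/=; apply: eq_bigr => i _.
by rewrite tnth_mktuple intrD mulrDl.
Qed.

Lemma idotN k x : idot [tuple - tnth k i | i < n] x = - idot k x.
Proof.
rewrite /idot -sumrN; apply: eq_bigr => i _.
by rewrite tnth_mktuple mulrNz mulNr.
Qed.

Lemma dotR_tshift xi k x : dotR (tshift xi k) x = dotR xi x + idot k x.
Proof.
rewrite /dotR /idot -big_split/=; apply: eq_bigr => i _.
by rewrite tnth_mktuple mulrDl.
Qed.

Lemma idot_coord i (x : n.-tuple R) :
  idot [tuple ((j == i)%:Z : int) | j < n] x = tnth x i.
Proof.
rewrite /idot (bigD1 i)//= tnth_mktuple eqxx mul1r big1 ?addr0// => j ji.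
by rewrite tnth_mktuple (negbTE ji) mul0r.
Qed.

(** The free phase [t] includes the sines and keeps everything real: these stand for the characters
    of the torus. *)
Definition waves : set (n.-tuple R -> R) :=
  [set f | exists k t, f = fun x => cos (2 * pi * idot k x + t)].

Lemma waves1 : waves (cst 1).
Proof.
exists [tuple 0 | i < n], 0; apply/funext => x.
rewrite /idot big1 ?mulr0 ?addr0 ?cos0// => i _.
by rewrite tnth_mktuple mul0r.
Qed.

Lemma waves_bounded f : waves f -> exists C : R, forall x, `|f x| <= C.
Proof. by move=> [k [t ->]]; exists 1 => x; exact: cos_max. Qed.

Lemma cosMcos (a b : R) :
  cos a * cos b = 1 / 2 * cos (a + b) + 1 / 2 * cos (a - b).
Proof. by rewrite cosD cosB; field. Qed.

Lemma waves_mul f g : waves f -> waves g -> blclosure waves (fun x =>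
  f x * g x).
Proof.
move=> [k [s ->]] [l [t ->]]; have Z := @blclosureZ _ _ _ waves1.
rewrite (_ : (fun x => _) = fun x =>
  1 / 2 * cos (2 * pi * idot [tuple tnth k i + tnth l i | i < n] x + (s + t)) +
  1 / 2 * cos (2 * pi * idot [tuple tnth k i + tnth [tuple - tnth l j | j < n]
    i | i < n] x + (s - t))).
  apply: blclosure_lin; first by apply: blclosure_base; do 2 eexists.
  by apply: Z; apply: blclosure_base; do 2 eexists.
apply/funext => x; rewrite cosMcos !idotD idotN.
by congr (_ * cos _ + _ * cos _); ring.
Qed.

Lemma measurable_idot k : measurable_fun setT (idot k).
Proof.
apply: measurable_sum => i; apply: measurable_funM => //.
exact: measurable_tnth.
Qed.

Lemma measurable_dotR xi : measurable_fun setT (dotR xi).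
Proof.
apply: measurable_sum => i; apply: measurable_funM => //.
exact: measurable_tnth.
Qed.

Lemma measurable_cos : measurable_fun setT (@cos R).
Proof. by apply: continuous_measurable_fun; exact: continuous_cos. Qed.

Lemma measurable_sin : measurable_fun setT (@sin R).
Proof. by apply: continuous_measurable_fun; exact: continuous_sin. Qed.

Lemma waves_meas f : waves f -> measurable_fun setT f.
Proof.
move=> [k [t ->]]; apply: (measurableT_comp measurable_cos).
by apply: measurable_funD => //; apply: measurable_funM => //;
  exact: measurable_idot.
Qed.

Lemma measurable_tshift k : measurable_fun setT (fun x => tshift x k).
Proof.
apply/measurable_fun_tnthP => i; apply: (eq_measurable_fun (fun x =>
  tnth x i + (tnth k i)%:~R)).
  by move=> x _; rewrite /= tnth_mktuple.
by apply: measurable_funD => //; exact: measurable_tnth.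
Qed.

Definition tfracpart x : n.-tuple R := [tuple fracpart (tnth x i) | i < n].

(** This is the union of all integral translates of [E], written through fractional parts so that
    its measurability rests on theirs alone. *)
Definition periodization (E : set (n.-tuple R)) : set (n.-tuple R) :=
  \bigcup_(k in [set: n.-tuple int]) [set x | E (tshift (tfracpart x) k)].

Lemma blclosure_set_periodization E :
  measurable E -> blclosure_set waves (periodization E).
Proof.
move=> mE.
have sV := sigma_algebra_blclosure_set _ waves1 waves_bounded waves_mul.
(* [T'] is the same space with the sigma-algebra of sets whose indicator lies in the closure of
   [waves]; the goal becomes measurability in [T']. *)
pose T' := g_sigma_algebraType (blclosure_set waves).
have mT' F : (measurable (F : set T')) = blclosure_set waves F.
  by rewrite [measurable](measurable_g_measurableTypeE sV).
have mw (k : n.-tuple int) t : measurable_fun [set: T'] (fun x : T' =>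
  cos (2 * pi * idot k x + t)).
  apply: (measurability _ (RGenOInfty.measurableE R)).
  move=> _ [_ [a ->] <-]; rewrite setTI mT'.
  rewrite (_ : _ @^-1` _ = [set x | a < cos (2 * pi * idot k x + t)]).
    apply: (blclosure_set_gt _ waves1 waves_bounded waves_mul).
    by apply: blclosure_base; do 2 eexists.
  by apply/seteqP; split => x /=; rewrite in_itv/= andbT.
have mfr : measurable_fun [set: T'] (tfracpart : T' -> _).
  apply/measurable_fun_tnthP => i.
  apply: (eq_measurable_fun (fun x : T' => fracpart (tnth x i))).
    by move=> x _; rewrite /= tnth_mktuple.
  (* The frequency is the [i]-th unit vector; the phase 0 gives the cosine of the coordinate, the
     phase - pi / 2 its sine. *)
  apply: measurable_fracpart.
    apply: (eq_measurable_fun _ _ (mw [tuple ((j == i)%:Z : int) | j < n] 0)).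
    by move=> x _; rewrite idot_coord addr0.
  apply: (eq_measurable_fun _ _ (mw [tuple ((j == i)%:Z : int) | j < n] (- (pi
    / 2)))).
  by move=> x _; rewrite idot_coord cosBpihalf.
rewrite -mT'; apply: countable_bigcupT_measurable => [|k].
  exact: countableP.
have := measurableT_comp (measurable_tshift k) mfr.
by move=> /(_ measurableT E mE); rewrite setTI.
Qed.

Lemma periodization_sub (E : set (n.-tuple R)) : E `<=` periodization E.
Proof.
move=> x Ex; exists [tuple Num.floor (tnth x i) | i < n] => //=.
rewrite (_ : tshift _ _ = x)//; apply: eq_from_tnth => i.
by rewrite !tnth_mktuple subrK.
Qed.

(** A point of the periodization is an integral translate of a point of [E]; a zero translation
    would put it in [E]. *)
Lemma periodization_diff (E : set (n.-tuple R)) : periodization E `\` E `<=`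
  \bigcup_(k in [set k : n.-tuple int | k != [tuple of nseq n 0%R]]) translate
    E k.
Proof.
move=> x [[k _ /= Ek] nEx].
pose l := [tuple Num.floor (tnth x i) - tnth k i | i < n].
have xE : x = tshift (tshift (tfracpart x) k) l.
  apply: eq_from_tnth => i; rewrite !tnth_mktuple intrB /fracpart; ring.
exists l; last by exists (tshift (tfracpart x) k).
apply/eqP => l0; apply: nEx; rewrite xE l0.
rewrite (_ : tshift _ [tuple of nseq n 0] = tshift (tfracpart x) k)//.
by apply: eq_from_tnth => i; rewrite [LHS]tnth_mktuple tnth_nseq addr0.
Qed.

Lemma translateE (E : set (n.-tuple R)) k :
  translate E k = (fun x => tshift x [tuple - tnth k i | i < n]) @^-1` E.
Proof.
apply/seteqP; split => [_ [x Ex ->]|x Ex] /=.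
  rewrite (_ : tshift _ _ = x)//; apply: eq_from_tnth => i.
  by rewrite !tnth_mktuple mulrNz addrK.
exists (tshift x [tuple - tnth k i | i < n]) => //.
by apply: eq_from_tnth => i; rewrite !tnth_mktuple mulrNz subrK.
Qed.

Lemma measurable_translate (E : set (n.-tuple R)) k :
  measurable E -> measurable (translate E k).
Proof. by move=> mE; rewrite translateE -[X in measurable X]setTI;
  exact: measurable_tshift. Qed.

End trigonometric.

(** * Consequences of a zero of the transform *)

Section vanishing.
Context {R : realType} {n : nat}.
Variables (mu : probability (n.-tuple R) R) (xi : n.-tuple R).
Hypothesis Zxi : Zset mu xi.

Lemma integrable_phase (f : R -> R) (g : n.-tuple R -> R) :
  measurable_fun setT f -> (forall y, `|f y| <= 1) -> measurable_fun setT g ->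
  mu.-integrable setT (fun x => (f (g x))%:E).
Proof.
move=> mf f1 mg; apply: measurable_bounded_integrable => //.
- exact: le_lt_trans (probability_le1 mu measurableT) (ltry _).
- exact: measurableT_comp.
- by exists 1; split => // y y1 x _; exact: le_trans (f1 _) (ltW y1).
Qed.

(** The addition formula reduces any phase to the real and imaginary parts of the transform. *)
Lemma Zset_phase k t :
  (\int[mu]_x (cos (2 * pi * dotR (tshift xi k) x + t))%:E = 0)%E.
Proof.
have md : measurable_fun setT (fun x => 2 * pi * dotR (tshift xi k) x).
  by apply: measurable_funM => //; exact: measurable_dotR.
have ic := integrable_phase _ _ measurable_cos (@cos_max R) md.
have ins := integrable_phase _ _ measurable_sin (@sin_max R) md.
have [c0 s0] : (\int[mu]_x (cos (2 * pi * dotR (tshift xi k) x))%:E = 0)%E /\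
    (\int[mu]_x (sin (2 * pi * dotR (tshift xi k) x))%:E = 0)%E.
  have := Zxi k; rewrite /fourier /Rintegral => -[c0 /eqP].
  rewrite oppr_eq0 => /eqP s0.
  split.
    (* [Rintegral] would also be 0 for an infinite integral; integrability excludes that case. *)
    by rewrite -[LHS](fineK (integrable_fin_num measurableT ic)) c0.
  by rewrite -[LHS](fineK (integrable_fin_num measurableT ins)) s0.
transitivity (\int[mu]_x ((cos t)%:E * (cos (2 * pi * dotR (tshift xi k) x))%:E
  -
    (sin t)%:E * (sin (2 * pi * dotR (tshift xi k) x))%:E))%E.
  by apply: eq_integral => x _;
    rewrite cosD EFinB !EFinM [X in (X - _)%E]muleC [X in (_ - X)%E]muleC.
rewrite integralB//=; try exact: integrableZl.
by rewrite !integralZl//= c0 s0 !mule0 sube0.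
Qed.

(** Turning the product into a sum leaves the frequencies xi + k and xi - k, both integral shifts of
    [xi]. *)
Lemma Zset_waves a f : waves f ->
  (\int[mu]_x (cos (2 * pi * dotR xi x + a) * f x)%:E = 0)%E.
Proof.
move=> [k [t ->]].
pose l := [tuple - tnth k i | i < n].
transitivity (\int[mu]_x ((1 / 2)%:E * (cos (2 * pi * dotR (tshift xi k) x + (a
  + t)))%:E +
    (1 / 2)%:E * (cos (2 * pi * dotR (tshift xi l) x + (a - t)))%:E))%E.
  apply: eq_integral => x _; rewrite cosMcos EFinD !EFinM !dotR_tshift idotN.
  by congr (_ * (cos _)%:E + _ * (cos _)%:E)%E; ring.
have i k' b : mu.-integrable setT (fun x =>
  (cos (2 * pi * dotR (tshift xi k') x + b))%:E).
  apply: (integrable_phase _ (fun x =>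
    2 * pi * dotR (tshift xi k') x + b) measurable_cos (@cos_max R)).
  by apply: measurable_funD => //; apply: measurable_funM => //;
    exact: measurable_dotR.
rewrite integralD//=; try exact: integrableZl.
by rewrite !integralZl//= !Zset_phase !mule0 adde0.
Qed.

Lemma Zset_null (E : set (n.-tuple R)) a : measurable E ->
  (forall k : n.-tuple int, k != [tuple of nseq n 0%R] -> mu (translate E k) =
    0%E) ->
  (forall x, E x -> 0 < cos (2 * pi * dotR xi x + a)) -> mu E = 0%E.
Proof.
move=> mE E0 Epos; set w := fun x => cos (2 * pi * dotR xi x + a).
have iw : mu.-integrable setT (EFin \o w).
  apply: (integrable_phase _ (fun x =>
    2 * pi * dotR xi x + a) measurable_cos (@cos_max R)).
  by apply: measurable_funD => //; apply: measurable_funM => //;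
    exact: measurable_dotR.
have [mF F0] := blclosure_set_integral0 _ _ _ iw waves_bounded waves_meas
  (Zset_waves a) _ (blclosure_set_periodization _ mE).
have D0 : mu (periodization E `\` E) = 0%E.
  apply: measure_negligible; first exact: measurableD.
  apply: negligibleS (periodization_diff E) _.
  pose N m := if unpickle m is Some k then
    if k == [tuple of nseq n 0%R] then set0 else translate E k else set0.
  apply: (@negligibleS _ _ _ _ (\bigcup_m N m)).
    by move=> x [k /= /negbTE k0 Ekx]; exists (pickle k) => //;
      rewrite /N pickleK k0.
  apply: negligible_bigcup => m; rewrite /N.
  case: unpickle => [k|]; last exact: negligible_set0.
  case: eqVneq => [_|k0]; first exact: negligible_set0.
  by apply/negligibleP; [exact: measurable_translate|exact: E0].
(* Removing the null set outside [E] carries the zero integral of [w] from the periodization to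
   [E]. *)
have := negligible_integral (measurableD mF mE) mF (integrableS measurableT mF
  (@subsetT _ _) iw) D0.
rewrite setDD (setIidr (periodization_sub E)) F0 => /esym intE0.
have mw : measurable_fun E (EFin \o w).
  exact: measurable_funS (measurable_int mu iw).
(* As [w] is positive on [E], its integral is that of |w|, so [w] vanishes almost everywhere on [E];
   hence [E] is null. *)
have /(ae_eq_integral_abs mu mE mw)[N [mN N0 EN]] :
  (\int[mu]_(x in E) `|(EFin \o w) x| = 0)%E.
  rewrite -[RHS]intE0; apply: eq_integral => x; rewrite inE => Ex /=.
  by rewrite gtr0_norm// Epos.
apply: measure_negligible => //; exists N; split => // x Ex.
apply: EN => /= /(_ Ex) [wx0].
by have := Epos x Ex; rewrite -/(w x) wx0 ltxx.
Qed.

End vanishing.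

(** * Covering the set by four phases *)

Theorem theorem1p3 (R : realType) (n : nat)
  (mu : probability (n.-tuple R) R) (E : set (n.-tuple R))
  (mE : measurable E) (posE : (0 < mu E)%E)
  (hE : forall k : n.-tuple int, k != [tuple of nseq n 0%R] ->
        mu (translate E k) = 0%E) :
  Zset mu = set0.
Proof.
apply/seteqP; split => // xi Zxi.
pose P a := E `&` [set x | 0 < cos (2 * pi * dotR xi x + a)].
have mP a : measurable (P a).
  have mc : measurable_fun setT (fun x : n.-tuple R =>
    cos (2 * pi * dotR xi x + a)).
    apply: (measurableT_comp measurable_cos); apply: measurable_funD => //.
    by apply: measurable_funM => //; exact: measurable_dotR.
  apply: measurableI => //.
  have := mc measurableT `]0, +oo[%classic (measurable_itv _); rewrite setTI.
  rewrite (_ : _ @^-1` _ = [set x | 0 < cos (2 * pi * dotR xi x + a)])//.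
  by apply/seteqP; split => x /=; rewrite in_itv/= andbT.
have P0 a : mu.-negligible (P a).
  apply/negligibleP => //; apply: (Zset_null _ _ Zxi _ a) => // [k k0|x []//].
  (* Translates of [P a] lie in the corresponding translates of [E], so they are null too. *)
  apply: measure_negligible; first exact: measurable_translate.
  exists (translate E k); split; [exact: measurable_translate|exact: hE|].
  by move=> _ [x [Ex _] ->]; exists x.
have : mu.-negligible E.
  (* The four phases give cos, - cos, - sin and sin; one of them is positive because cos and sin
     never vanish together. *)
  apply: negligibleS (negligibleU (negligibleU (P0 0) (P0 pi))
    (negligibleU (P0 (pi / 2)) (P0 (- (pi / 2))))) => x Ex.
  rewrite /P /= addr0 cosDpi cosDpihalf cosBpihalf !oppr_gt0.
  have := cos2Dsin2 (2 * pi * dotR xi x).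
  case: (ltgtP 0 (cos _)) => [c|c|<-]; [by left; left|by left; right|].
  case: (ltgtP 0 (sin _)) => [s|s|<-]; [by right; right|by right; left|].
  by rewrite expr0n/= addr0 => /eqP; rewrite eq_sym oner_eq0.
by move=> /(measure_negligible mE) muE0; rewrite muE0 ltxx in posE.
Qed.
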